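(* Let $m$ be a positive integer and let $\alpha=(\alpha_{k+m})_{k\in\mathbb N}$ be a sequence of positive real constants. Let $(P_n(x))_{n\in\mathbb N}$ be the $m$-orthogonal polynomial sequence with respect to the vector of linear functionals $(u_0,\dots,u_{m-1})$ on $\mathbb R[x]$ and to the vector of measures $(\mu_0,\dots,\mu_{m-1})$ supported on a subset of the positive real line $\mathbb R^+$ such that $$u_k[x^n]=S^{(m)}_{n,k}(\alpha)\quad\text{and}\quad\int x^n\,\mathrm d\mu_k(x)=S^{(m;k)}_n(\alpha)\qquad\text{for all }n\in\mathbb N\text{ and }0\leq k\leq m-1.$$ Then, the zeros of $P_n(x)$ are all simple, real, and positive, and the zeros of consecutive polynomials interlace. Furthermore, the coefficients $$\gamma^{[k]}_n=\sum_{m\geq\ell_0>\cdots>\ell_k\geq 0}\ \prod_{j=0}^{k}\alpha_{(m+1)(n+j)+\ell_j}\qquad(n\in\mathbb N,\ 0\leq k\leq m),$$ where $\alpha_j=0$ for $0\leq j\leq m-1$, of the recurrence relation $$P_{n+1}(x)=x\,P_n(x)-\sum_{k=0}^{\min(m,n)}\gamma^{[k]}_{n-k}\,P_{n-k}(x),\qquad P_0(x)=1,$$ satisfied by $(P_n(x))_{n\in\mathbb N}$ are all positive.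
   Context: $\mathbb N=\{0,1,2,\dots\}$. A partial $m$-Dyck path is a finite path in $\mathbb N\times\mathbb N$ using steps $(1,1)$ (rises) and $(1,-m)$ ($m$-falls), allowed to start and end anywhere in $\mathbb N\times\mathbb N$. Each rise gets weight $1$ and each $m$-fall from height $i$ gets weight $\alpha_i$; the weight of a path is the product of the weights of its steps. The generalised $m$-Stieltjes-Rogers polynomial $S^{(m)}_{n,k}(\alpha)$ is the sum of the weights of the partial $m$-Dyck paths from $(0,0)$ to $((m+1)n,(m+1)k)$. The modified $m$-Stieltjes-Rogers polynomial of type $j$, $S^{(m;j)}_{n}(\alpha)$, is the sum of the weights of the partial $m$-Dyck paths from $(0,0)$ to $((m+1)n+j,j)$. For $d\ge 1$, a sequence $(P_n(x))_{n\in\mathbb N}$ of monic polynomials with $\deg P_n=n$ is $d$-orthogonal with respect to linear functionals $(u_0,\dots,u_{d-1})$ if, for all $j\in\{0,\dots,d-1\}$ and $k,n\in\mathbb N$, $u_j[x^kP_n]\neq0$ if $n=dk+j$ and $u_j[x^kP_n]=0$ if $n\geq dk+j+1$; $d$-orthogonality with respect to measures $(\mu_0,\dots,\mu_{d-1})$ means $d$-orthogonality with respect to the functionals $f\mapsto\int f\,\mathrm d\mu_j$. Interlacing of the zeros of consecutive polynomials means that strictly between any two consecutive zeros of $P_{n+1}$ there is exactly one zero of $P_n$. *)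

(* Defs.v *)
From HB Require Import structures.
From mathcomp Require Import all_boot all_order all_algebra.
From mathcomp Require Import complex.
From mathcomp Require Import all_classical all_reals all_analysis.

Set Implicit Arguments.
Unset Strict Implicit.
Unset Printing Implicit Defensive.

Import Order.TTheory GRing.Theory Num.Theory.
Local Open Scope ring_scope.

(* A partial m-Dyck path is encoded by the height of its starting point and
   the list of its steps: true is the rise (1, 1), false is the m-fall (1, -m).
   Both steps have horizontal length 1, so a path from (a, h) with step list s
   ends at abscissa a + size s. *)

(* The path never leaves N x N: a fall is only allowed from a height >= m. *)
Fixpoint is_dyck_path (m h : nat) (s : seq bool) : bool :=
  match s with
  | [::] => true
  | true :: s' => is_dyck_path m h.+1 s'
  | false :: s' => (m <= h)%N && is_dyck_path m (h - m)%N s'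
  end.

Fixpoint end_height (m h : nat) (s : seq bool) : nat :=
  match s with
  | [::] => h
  | true :: s' => end_height m h.+1 s'
  | false :: s' => end_height m (h - m)%N s'
  end.

Fixpoint path_weight (R : comNzRingType) (alpha : nat -> R)
    (m h : nat) (s : seq bool) : R :=
  match s with
  | [::] => 1
  | true :: s' => path_weight alpha m h.+1 s'
  | false :: s' => alpha h * path_weight alpha m (h - m)%N s'
  end.

(* Weighted count of the partial m-Dyck paths from (0, 0) to (N, h). *)
Definition dyck_sum (R : comNzRingType) (alpha : nat -> R) (m N h : nat) : R :=
  \sum_(s : N.-tuple bool | is_dyck_path m 0 s && (end_height m 0 s == h))
    path_weight alpha m 0 s.

Definition stieltjes_rogers (R : comNzRingType) (alpha : nat -> R)
    (m n k : nat) : R :=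
  dyck_sum alpha m (m.+1 * n) (m.+1 * k).

Definition mod_stieltjes_rogers (R : comNzRingType) (alpha : nat -> R)
    (m j n : nat) : R :=
  dyck_sum alpha m (m.+1 * n + j) j.

Definition d_orthogonal (R : comNzRingType) (d : nat)
    (u : 'I_d -> {poly R} -> R) (P : nat -> {poly R}) : Prop :=
  [/\ forall n, P n \is monic,
      forall n, size (P n) = n.+1
    & forall (j : 'I_d) (k n : nat),
        (n = (d * k + j)%N -> u j ('X^k * P n) <> 0) /\
        ((d * k + j + 1 <= n)%N -> u j ('X^k * P n) = 0)].

Definition integral_functional (R : realType)
    (mu : {measure set (measurableTypeR R) -> \bar R}) (p : {poly R}) : R :=
  \int[mu]_(x in setT) p.[x].

(* k.+1 factors: l ranges over the maps from {0, ..., k} to {0, ..., m}. *)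
Definition rec_coef (R : comNzRingType) (alpha : nat -> R) (m k n : nat) : R :=
  \sum_(l : {ffun 'I_k.+1 -> 'I_m.+1} |
          [forall i : 'I_k.+1, forall j : 'I_k.+1, (i < j)%N ==> (l j < l i)%N])
    \prod_(j < k.+1) alpha (m.+1 * (n + j) + l j)%N.

Definition consecutive_zeros (R : realType) (p : {poly R}) (x y : R) : Prop :=
  [/\ x < y, root p x, root p y & forall z, x < z < y -> ~~ root p z].

Definition zeros_interlace (R : realType) (p q : {poly R}) : Prop :=
  forall x y, consecutive_zeros q x y -> exists! z, (x < z < y) && root p z.

(* Over R[i], so that it says that p has no non-real zeros. *)
Definition zeros_simple_real_positive (R : realType) (p : {poly R}) : Prop :=
  let pC : {poly R[i]} := map_poly (real_complex R) p in
  forall z : R[i], root pC z ->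
    mup z pC = 1%N /\ exists2 x : R, z = real_complex R x & 0 < x.

(* Main.v *)
Require Import Defs.
From HB Require Import structures.
From mathcomp Require Import all_boot all_order all_algebra.
From mathcomp Require Import complex.
From mathcomp Require Import all_classical all_reals all_analysis.
From mathcomp Require Import polyrcf zify.

(* Let A_0 = 1 and A_(h+1) = e_(h+1) A_h - alpha_h A_(h-m), where e_h is 'X if
   m+1 divides h and 1 otherwise.  Iterating along Dyck paths, the sum over the
   step lists s of length N of the weight of s from height h, times A at the end
   of s, is a power of 'X times A_h.  For N = m+1 this says that
   Q_n = A_((m+1)n) satisfies the recurrence, and for h = 0 that
   'X^n = \sum_i S_(n,i) Q_i.  Hence u_j[Q_n] is 0 or 1 according to n = j, and
   the recurrence propagates this to the orthogonality relations, so P_n = Q_n.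
   For the zeros, A_i and A_j strictly interlace whenever i < j <= i + m + 1, by
   induction on j: at a zero z of A_i, both terms of the recurrence for A_j push
   A_j(z) to the sign opposite to A_i'(z), and the sign of A_j(0) accounts for
   the last zero. *)

Set Implicit Arguments.
Unset Strict Implicit.
Unset Printing Implicit Defensive.

Import Order.TTheory GRing.Theory Num.Theory.
Local Open Scope ring_scope.

(** * Alternating zeros *)

(** The enumeration is decreasing, so that [s k] has exactly [k] zeros above it and signs become
    powers of -1 in [k]. *)
Definition positive_zeros (R : rcfType) (d : nat) (s : nat -> R)
    (f : {poly R}) : Prop :=
  [/\ forall i j, (i < j < d)%N -> s j < s i,
      forall i, (i < d)%N -> 0 < s i
    & f = \prod_(i < d) ('X - (s i)%:P)].

(* The zeros alternate, and the largest one belongs to [g]. *)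
Definition interlaces (R : rcfType) (f g : {poly R}) : Prop :=
  exists d e s t, [/\ positive_zeros d s f, positive_zeros e t g,
    (d <= e <= d.+1)%N, forall k, (k < d)%N -> s k < t k
    & forall k, (k.+1 < e)%N -> t k.+1 < s k].

Lemma sign_prod (R : comNzRingType) (d k : nat) : (k <= d)%N ->
  \prod_(i < d) (if (i < k)%N then -1 else 1 : R) = (-1) ^+ k.
Proof.
move=> kd; rewrite -(big_mkord xpredT (fun i => if (i < k)%N then -1 else 1)).
rewrite (big_cat_nat (n := k)) //= [X in _ * X]big1_seq ?mulr1; last first.
  by move=> i; rewrite mem_index_iota => /andP[_ /andP[ki _]]; rewrite ltnNge ki.
rewrite (eq_big_nat _ _ (F2 := fun _ => -1)); last by move=> i /andP[_ ->].
by rewrite prodr_const_nat subn0.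
Qed.

Lemma mulr_sign_lt0 (R : realDomainType) (k : nat) (a b : R) :
  0 < (-1) ^+ k * a -> 0 < (-1) ^+ k.+1 * b -> a * b < 0.
Proof.
move=> ha hb; have := mulr_gt0 ha hb.
by rewrite mulrACA exprS [_ ^+ k * _]mulrCA -expr2 sqrr_sign mulr1 mulN1r oppr_gt0.
Qed.

Lemma sign_horner_prod (R : rcfType) (d k : nat) (s : nat -> R) (x : R) :
  (k <= d)%N -> (forall i, (i < k)%N -> x < s i) ->
  (forall i, (k <= i < d)%N -> s i < x) ->
  0 < (-1) ^+ k * (\prod_(i < d) ('X - (s i)%:P)).[x].
Proof.
move=> kd lo hi; rewrite horner_prod -(sign_prod R kd) -big_split /=.
apply: prodr_gt0 => i _; rewrite hornerXsubC; case: ltnP => ik.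
  by rewrite mulN1r opprB subr_gt0 lo.
by rewrite mul1r subr_gt0 hi // ik ltn_ord.
Qed.

(** By the product rule only the product of the other factors survives at [s k], and [k] of these
    are negative. *)
Lemma sign_deriv_prod (R : rcfType) (d k : nat) (s : nat -> R) :
  (forall i j, (i < j < d)%N -> s j < s i) -> (k < d)%N ->
  0 < (-1) ^+ k * (\prod_(i < d) ('X - (s i)%:P))^`().[s k].
Proof.
move=> dec kd; rewrite -(sign_prod R (ltnW kd)) (bigD1 (Ordinal kd)) //=.
rewrite ltnn mul1r [X in X^`()](bigD1 (Ordinal kd)) //= derivM derivXsubC mul1r.
rewrite hornerD hornerM hornerXsubC subrr mul0r addr0 horner_prod -big_split /=.
apply: prodr_gt0 => i ik; rewrite hornerXsubC; case: ltnP => lik.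
  by rewrite mulN1r opprB subr_gt0 dec // lik.
rewrite mul1r subr_gt0 dec // ltn_ord andbT ltn_neqAle lik andbT eq_sym.
by rewrite -val_eqE in ik.
Qed.

Lemma positive_zerosP (R : rcfType) (d : nat) (s : nat -> R) (f : {poly R})
    (z : R) : positive_zeros d s f ->
  reflect (exists2 k, (k < d)%N & z = s k) (root f z).
Proof.
case=> _ _ ->; rewrite rootE horner_prod; apply: (iffP (prodf_eq0 _ _)).
  by case=> i _ /eqP; rewrite hornerXsubC => /eqP; rewrite subr_eq0 => /eqP ->; exists i.
by case=> k kd ->; exists (Ordinal kd) => //; rewrite hornerXsubC subrr.
Qed.

(** The zeros of [g] above [s k] are [t 0], ..., [t k], one more than those of [f], so the two signs
    differ. *)
Lemma interlaces_deriv_lt0 (R : rcfType) (f g : {poly R}) (z : R) :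
  interlaces f g -> root f z -> g.[z] * f^`().[z] < 0.
Proof.
case=> d [e [s [t [fs gt de st ts]]]] /(positive_zerosP z fs)[k kd ->].
have [decs _ ->] := fs; have [dect _ ->] := gt.
have h1 := sign_deriv_prod decs kd.
have h2 : 0 < (-1) ^+ k.+1 * (\prod_(i < e) ('X - (t i)%:P)).[s k].
  apply: sign_horner_prod => [|i ik|i ik]; first by lia.
    apply: lt_le_trans (st k kd) _; case: (ltngtP i k) => [?|?|->//]; last by lia.
    by apply/ltW/dect; lia.
  apply: le_lt_trans (ts k _); last by lia.
  case: (ltngtP i k.+1) => [?|?|->//]; first by lia.
  by apply/ltW/dect; lia.
by rewrite mulrC; apply: mulr_sign_lt0 h1 h2.
Qed.

(** Above [t k] there are [k] zeros of [f], as many as of [g], so the two signs agree. *)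
Lemma interlaces_deriv_gt0 (R : rcfType) (f g : {poly R}) (z : R) :
  interlaces f g -> root g z -> 0 < f.[z] * g^`().[z].
Proof.
case=> d [e [s [t [fs gt de st ts]]]] /(positive_zerosP z gt)[k ke ->].
have [decs _ ->] := fs; have [dect _ ->] := gt.
have h1 := sign_deriv_prod dect ke.
have h2 : 0 < (-1) ^+ k * (\prod_(i < d) ('X - (s i)%:P)).[t k].
  apply: sign_horner_prod => [|i ik|i ik]; first by lia.
    case: k ke ik {h1} => // k ke ik; apply: lt_le_trans (ts k ke) _.
    case: (ltngtP i k) => [?|?|->//]; last by lia.
    by apply/ltW/decs; lia.
  apply: le_lt_trans (st k _); last by lia.
  case: (ltngtP i k) => [?|?|->//]; first by lia.
  by apply/ltW/decs; lia.
have := mulr_gt0 h1 h2.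
by rewrite mulrACA -expr2 sqrr_sign mul1r mulrC.
Qed.

(** The sign of [g] alternates along a large point, the zeros of [f] and, if e = d + 1, the point 0.
    The intermediate value theorem yields [e] zeros, which is all the degree allows. *)
Lemma interlaces_from_signs (R : rcfType) (d e : nat) (s : nat -> R)
    (f g : {poly R}) :
  positive_zeros d s f -> g \is monic -> size g = e.+1 -> (d <= e <= d.+1)%N ->
  0 < (-1) ^+ e * g.[0] ->
  (forall z, root f z -> g.[z] * f^`().[z] < 0) ->
  interlaces f g.
Proof.
move=> fs gmon gsz de g0 gf.
have [decs poss fE] := fs.
have gs k : (k < d)%N -> 0 < (-1) ^+ k.+1 * g.[s k].
  move=> kd; have h1 := sign_deriv_prod decs kd; rewrite -fE in h1.
  have := gf (s k); move/(_ (introT (positive_zerosP _ fs) (ex_intro2 _ _ k kd erefl))).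
  rewrite exprS mulN1r mulNr oppr_gt0 => h2.
  by rewrite -(pmulr_llt0 _ h1) mulrACA -expr2 sqrr_sign mul1r.
have [B Bgt] : exists B, forall x, B <= x -> 0 < g.[x].
  have lg : 0 < lead_coef g by rewrite (eqP gmon).
  have [B HB] := poly_pinfty_gt_lc lg.
  by exists B => x Bx; apply: lt_le_trans lg (HB _ _).
(* The zero [t k] is sought between [lo k] and [up k]. The end 0 serves as [lo d] when e = d + 1;
   the maximum in [up 0] ensures both that [g] is positive there and that [lo 0 < up 0]. *)
pose lo k := if (k < d)%N then s k else 0.
pose up k := if k is k'.+1 then s k' else Num.max B (lo 0%N + 1).
have [t ht] : exists t : nat -> R, forall k, (k < e)%N ->
    [/\ root g (t k), lo k < t k & t k < up k].
  have /choice[t ht] : forall k, exists y, (k < e)%N ->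
    [/\ root g y, lo k < y & y < up k]; last by exists t.
  move=> k; have [ke|_] := ltnP k e; last by exists 0.
  have g_lo : 0 < (-1) ^+ k.+1 * g.[lo k].
    rewrite /lo; case: ltnP => kd; first exact: gs.
    by have -> : k.+1 = e by lia.
  have g_up : 0 < (-1) ^+ k * g.[up k].
    case: k ke {g_lo} => [|k] ke /=.
      by rewrite mul1r; apply: Bgt; rewrite le_max lexx.
    by apply: gs; lia.
  have lo_up : lo k < up k.
    case: k ke {g_lo g_up} => [|k] ke /=; first by rewrite lt_max ltrDl ltr01 orbT.
    by rewrite /lo; case: ltnP => ?; [apply: decs | apply: poss]; lia.
  have [|y] := @poly_ivtoo _ g _ _ (ltW lo_up).
    by rewrite mulrC; apply: mulr_sign_lt0 g_up g_lo.
  by rewrite in_itv /= => /andP[? ?] ?; exists y.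
have t_gt_s k : (k < d)%N -> s k < t k.
  by move=> kd; have [_ + _] := ht k ltac:(lia); rewrite /lo kd.
have t_lt_s k : (k.+1 < e)%N -> t k.+1 < s k by move=> ke; have [] := ht _ ke.
have dect i j : (i < j < e)%N -> t j < t i.
  elim: j => // j IH /andP[ij je].
  apply: lt_trans (t_lt_s _ je) _; apply: lt_le_trans (t_gt_s _ _) _; first by lia.
  by move: ij; rewrite ltnS leq_eqVlt => /predU1P[->//|ij]; apply/ltW/IH; lia.
exists d, e, s, t; split=> //; split=> //.
  move=> i ie; have [_ + _] := ht _ ie; apply: le_lt_trans.
  by rewrite /lo; case: ltnP => // id; apply/ltW/poss.
have := @all_roots_prod_XsubC R g (mkseq t e).
rewrite size_mkseq (eqP gmon) scale1r big_map -(big_mkord xpredT (fun i => 'X - (t i)%:P)).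
rewrite /index_iota subn0; apply=> //.
  by apply/allP => _ /mapP[k + ->]; rewrite mem_iota => ke; have [] := ht k ltac:(lia).
rewrite uniq_rootsE map_inj_in_uniq ?iota_uniq // => i j.
rewrite !mem_iota => ie je tij.
by case: (ltngtP i j) => // ij; [have := dect i j|have := dect j i];
  rewrite tij ltxx ij /= => /(_ ltac:(lia)).
Qed.

(** The factorisation into distinct linear factors persists over [R[i]], leaving no room for other
    zeros. *)
Lemma positive_zeros_simple_real (R : realType) (d : nat) (s : nat -> R)
  (f : {poly R}) : positive_zeros d s f -> zeros_simple_real_positive f.
Proof.
move=> [dec pos fE] pC z.
have -> : pC = \prod_(x <- mkseq (fun i => real_complex R (s i)) d) ('X - x%:P).
  rewrite /pC fE rmorph_prod big_map.
  rewrite -(big_mkord xpredT (fun i => map_poly (real_complex R) ('X - (s i)%:P))).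
  by rewrite /index_iota subn0; apply: eq_bigr => i _; rewrite map_polyXsubC.
rewrite root_prod_XsubC => zin; split; last first.
  by move: zin => /mapP[k + ->]; rewrite mem_iota => kd; exists (s k) => //; apply: pos; lia.
rewrite mu_prod_XsubC count_uniq_mem ?zin // map_inj_in_uniq ?iota_uniq // => i j.
rewrite !mem_iota => ie je /complexI tij.
by case: (ltngtP i j) => // ij; [have := dec i j|have := dec j i];
  rewrite tij ltxx ij /= => /(_ ltac:(lia)).
Qed.

Lemma interlaces_zeros (R : realType) (f g : {poly R}) :
  interlaces f g -> zeros_interlace f g.
Proof.
case=> d [e [s [t [fs gt de st ts]]]] x y [xy].
move=> /(positive_zerosP _ gt)[i ie xE] /(positive_zerosP _ gt)[j je yE] noroot.
rewrite {x}xE {y}yE in xy noroot *; rename xy into tij.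
have [decs _ _] := fs; have [dect _ _] := gt.
have ji : (j < i)%N.
  rewrite ltnNge leq_eqVlt; apply/negP => /predU1P[eij|ij].
    by rewrite eij ltxx in tij.
  by move: (dect i j); rewrite ij je => /(_ isT) /(lt_trans tij); rewrite ltxx.
(* Otherwise [t j.+1] would be a zero strictly between the two. *)
have {}ji : i = j.+1.
  apply/eqP; rewrite eqn_leq ji andbT leqNgt; apply/negP => ji1.
  have := noroot (t j.+1); rewrite !dect; [|lia|lia] => /(_ isT) /negP; apply.
  by apply/(positive_zerosP _ gt); exists j.+1 => //; lia.
rewrite {i}ji in ie tij noroot *.
exists (s j); split.
  rewrite ts ?st //=; try lia.
  by apply/(positive_zerosP _ fs); exists j => //; lia.
move=> z /andP[/andP[jz zj] /(positive_zerosP _ fs)[k kd zE]].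
(* For uniqueness: [s k] with [k > j] lies below [t k <= t j.+1], and with [k < j] above
   [t k.+1 >= t j]. *)
have letk i k' : (i <= k' < e)%N -> t k' <= t i.
  by rewrite leq_eqVlt => /andP[/predU1P[->//|ik] ke]; apply/ltW/dect; rewrite ik.
rewrite {z}zE in jz zj *; congr s; case: (ltngtP j k) => // jk.
  have := lt_le_trans (lt_trans jz (st k kd)) (letk j.+1 k ltac:(lia)).
  by rewrite ltxx.
have := le_lt_trans (letk k.+1 j ltac:(lia)) (lt_trans (ts k ltac:(lia)) zj).
by rewrite ltxx.
Qed.

(** * The polynomials A_h *)

(** The recurrence reaches back m + 1 indices, so the recursion carries the list A_h, ..., A_0; the
    default 0 stands for negative indices. *)
Fixpoint dyck_poly_history (R : nzRingType) (alpha : nat -> R) (m h : nat) :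
    seq {poly R} :=
  if h is h'.+1 then
    let H := dyck_poly_history alpha m h' in
    ((if (m.+1 %| h)%N then 'X else 1) * head 0 H - alpha h' *: nth 0 H m) :: H
  else [:: 1].

(* If t ^+ (h %% m.+1) is put back in front of A_h(t ^+ m.+1), one obtains the
   polynomials q_h(t) with t q_h = q_(h+1) + alpha_h q_(h-m). *)
Definition dyck_poly (R : nzRingType) (alpha : nat -> R) (m h : nat) : {poly R} :=
  head 0 (dyck_poly_history alpha m h).

Lemma nth_dyck_poly_history (R : nzRingType) (alpha : nat -> R) (m h k : nat) :
  (k <= h)%N -> nth 0 (dyck_poly_history alpha m h) k = dyck_poly alpha m (h - k).
Proof.
by elim: h k => [|h IH] [|k] //= kh; exact: IH.
Qed.

(** For [h < m] the history gives 0 where the truncated [h - m] gives A_0; the factor [alpha h = 0]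
    reconciles the two. *)
Lemma dyck_polyS (R : nzRingType) (alpha : nat -> R) (m h : nat) :
  (forall j, (j < m)%N -> alpha j = 0) ->
  dyck_poly alpha m h.+1 = (if (m.+1 %| h.+1)%N then 'X else 1) * dyck_poly alpha m h
    - alpha h *: dyck_poly alpha m (h - m).
Proof.
move=> alpha0; rewrite {1}/dyck_poly /=; have [mh|/alpha0->] := leqP m h.
  by rewrite nth_dyck_poly_history.
by rewrite !scale0r.
Qed.

Lemma dyck_poly_monic_size (R : idomainType) (alpha : nat -> R) (m h : nat) :
  (forall j, (j < m)%N -> alpha j = 0) ->
  dyck_poly alpha m h \is monic /\ size (dyck_poly alpha m h) = (h %/ m.+1).+1.
Proof.
move=> alpha0; elim/ltn_ind: h => -[|h] IH.
  by rewrite /dyck_poly /= monic1 size_poly1 div0n.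
rewrite dyck_polyS //; set p := _ * _.
have [monh sizeh] := IH h (ltnSn h).
have [monp sizep] : p \is monic /\ size p = (h.+1 %/ m.+1).+1.
  rewrite /p divnS //; case: (m.+1 %| h.+1)%N; last by rewrite mul1r.
  by rewrite rpredM ?monicX // mulrC size_mulX ?monic_neq0 // sizeh.
(* Since h - m = (h + 1) - (m + 1), the subtracted term has degree one less than [p]. *)
have small : (size (- (alpha h *: dyck_poly alpha m (h - m))) < size p)%N.
  rewrite sizep size_polyN; have [mh|/alpha0->] := leqP m h; last by rewrite scale0r size_poly0.
  apply: leq_ltn_trans (size_scale_leq _ _) _; rewrite (IH _ _).2; last by lia.
  by rewrite -{2}(subnK mh) -addnS divnDr // divnn addn1.
by split; rewrite ?monicE ?lead_coefDl ?size_polyDl.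
Qed.

(** The degree drop between A_(h+1) and A_(h-m) cancels the minus sign of the recurrence, so its two
    terms never have opposite signs at 0. If the factor 'X kills the first, then [m <= h] and the
    second is nonzero. *)
Lemma dyck_poly_sign0 (R : rcfType) (alpha : nat -> R) (m h : nat) :
  (forall j, (j < m)%N -> alpha j = 0) ->
  (forall j, (m <= j)%N -> 0 < alpha j) ->
  0 < (-1) ^+ (h %/ m.+1) * (dyck_poly alpha m h).[0].
Proof.
move=> alpha0 alpha_gt0; elim/ltn_ind: h => -[|h] IH.
  by rewrite /dyck_poly /= hornerC mulr1 div0n.
rewrite dyck_polyS // hornerD hornerN hornerZ hornerM mulrDr.
have pos : (m <= h)%N -> 0 < (-1) ^+ (h.+1 %/ m.+1) * - (alpha h * (dyck_poly alpha m (h - m)).[0]).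
  move=> mh; have -> : (h.+1 %/ m.+1 = ((h - m) %/ m.+1).+1)%N.
    by rewrite -{1}(subnK mh) -addnS divnDr // divnn addn1.
  rewrite exprS mulN1r mulrNN mulrCA mulr_gt0 ?alpha_gt0 //; apply: IH; lia.
case: ifP => dvd.
  by rewrite hornerX mul0r mulr0 add0r pos //; move/dvdn_leq: dvd => /(_ isT).
rewrite hornerC mul1r addrC; have hE : (h.+1 %/ m.+1 = h %/ m.+1)%N by rewrite divnS // dvd.
have IHh := IH h (ltnSn h); have [/pos mh|mh] := leqP m h.
  by rewrite addr_gt0 // hE.
by rewrite alpha0 // mul0r oppr0 mulr0 add0r hE.
Qed.

(** The window of indices is closed under the recurrence: for j = h + 1 one has h - m <= i <= h, so
    A_i interlaces with A_h on one side and with A_(h-m) on the other, up to equality. *)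
Lemma dyck_poly_interlaces (R : rcfType) (alpha : nat -> R) (m i j : nat) :
  (0 < m)%N -> (forall j, (j < m)%N -> alpha j = 0) ->
  (forall j, (m <= j)%N -> 0 < alpha j) ->
  (i < j <= i + m.+1)%N -> interlaces (dyck_poly alpha m i) (dyck_poly alpha m j).
Proof.
move=> m0 alpha0 alpha_gt0; elim/ltn_ind: j i => -[|h] IH i // /andP[ih him].
(* The zeros of A_i come from its interlacing with A_(i-1); A_0 has none. *)
have [d [s fs]] : exists d s, positive_zeros d s (dyck_poly alpha m i).
  case: i ih him => [|i] ih him.
    by exists 0%N, (fun=> 0); split=> [? ?||]; rewrite ?andbF ?big_ord0.
  have [d [e [s [t [_ ? _ _ _]]]]] := IH i.+1 ltac:(lia) i ltac:(lia).
  by exists e, t.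
have dE : d = (i %/ m.+1)%N.
  have [_] := dyck_poly_monic_size i alpha0.
  have [_ _ ->] := fs.
  have := size_prod_XsubC (index_enum 'I_d) (fun i => s i).
  by rewrite /index_enum -enumT size_enum_ord => -> [].
have [mon sz] := dyck_poly_monic_size h.+1 alpha0.
apply: (interlaces_from_signs fs mon sz).
- rewrite dE (leq_div2r _ (ltnW ih)) /=.
  by have := leq_div2r m.+1 him; rewrite divnDr // divnn addn1.
- exact: dyck_poly_sign0.
move=> z iz; have z0 : 0 < z.
  by have /(positive_zerosP _ fs)[k kd ->] := iz; have [_ + _] := fs; apply.
(* A_i has a zero, hence positive degree, so [i] is at least m + 1; this makes [alpha h]
   positive. *)
have mh : (m <= h)%N.
  have /(positive_zerosP _ fs)[k] := iz; rewrite dE => ki _.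
  have : (0 < i %/ m.+1)%N by lia.
  by rewrite divn_gt0 // => ?; lia.
rewrite dyck_polyS // hornerD hornerN hornerZ hornerM mulrBl subr_lt0 -!mulrA.
set e := (if _ then _ else _).[z].
have e0 : 0 < e by rewrite /e; case: ifP; rewrite ?hornerX ?hornerC.
(* If [i = h], the first term vanishes at [z] and the second supplies the strict sign; otherwise the
   first is strict and the second may vanish, namely when [h - m = i]. *)
have [ei|lti] := eqVneq i h.
  have hz : root (dyck_poly alpha m h) z by rewrite -ei.
  rewrite (rootP hz) mul0r mulr0 pmulr_rgt0 ?alpha_gt0 // ei.
  apply: interlaces_deriv_gt0 hz; apply: IH; lia.
apply: (@lt_le_trans _ _ 0).
  by rewrite pmulr_rlt0 //; apply: interlaces_deriv_lt0 iz; apply: IH; lia.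
rewrite pmulr_rge0 ?alpha_gt0 //.
have [ihm|nihm] := eqVneq (h - m)%N i; first by rewrite ihm (rootP iz) mul0r.
by apply/ltW; apply: interlaces_deriv_gt0 iz; apply: IH; lia.
Qed.

(** * Sums over Dyck paths *)

Lemma big_tuple_cons (V : nmodType) (N : nat) (F : seq bool -> V) :
  \sum_(s : N.+1.-tuple bool) F s =
  \sum_(s : N.-tuple bool) F (true :: s) + \sum_(s : N.-tuple bool) F (false :: s).
Proof.
rewrite (reindex (fun p : bool * N.-tuple bool => [tuple of p.1 :: p.2])) /=; last first.
  apply: onW_bij; exists (fun s => (thead s, behead_tuple s)) => [[b s]|s] /=.
    by congr pair; apply: val_inj.
  by rewrite [RHS]tuple_eta.
by rewrite -(pair_bigA _ (fun (b : bool) (s : N.-tuple bool) => F (b :: s))) big_bool.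
Qed.

Lemma dyck_path_end (m h : nat) (s : seq bool) : is_dyck_path m h s ->
  (end_height m h s + m * count negb s = h + count id s)%N.
Proof.
elim: s h => [|[] s IH] h /=; first by rewrite muln0.
  by move=> /IH; lia.
by case/andP=> mh /IH; lia.
Qed.

(** An illegal fall starts below height [m], where [alpha] vanishes. Sums over Dyck paths may thus
    run over all step lists. *)
Lemma path_weight0 (R : comNzRingType) (alpha : nat -> R) (m h : nat) (s : seq bool) :
  (forall j, (j < m)%N -> alpha j = 0) ->
  ~~ is_dyck_path m h s -> path_weight alpha m h s = 0.
Proof.
move=> alpha0; elim: s h => [|[] s IH] h //=; first exact: IH.
by rewrite negb_and -ltnNge => /orP[/alpha0->|/IH->]; rewrite ?mul0r ?mulr0.
Qed.

Lemma count_id_negb (s : seq bool) : (count id s + count negb s = size s)%N.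
Proof. exact: count_predC. Qed.

(** Induction on the first step: a rise leads to A_(h+1), a fall to alpha_h A_(h-m), and these add
    up to e_(h+1) A_h. The exponent counts the multiples of m + 1 in the interval from h + 1 to h +
    N. *)
Lemma dyck_poly_path_sum (R : comNzRingType) (alpha : nat -> R) (m h N : nat) :
  (forall j, (j < m)%N -> alpha j = 0) ->
  \sum_(s : N.-tuple bool) path_weight alpha m h s *: dyck_poly alpha m (end_height m h s)
  = 'X^((h + N) %/ m.+1 - h %/ m.+1) * dyck_poly alpha m h.
Proof.
move=> alpha0; elim: N h => [|N IH] h.
  rewrite (big_pred1 [tuple]) /= => [|s]; first by rewrite scale1r addn0 subnn mul1r.
  by symmetry; apply/eqP; apply: tuple0.
rewrite (big_tuple_cons _ (fun s =>
  path_weight alpha m h s *: dyck_poly alpha m (end_height m h s))) /=.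
rewrite IH; under [X in _ + X]eq_bigr do rewrite -scalerA.
rewrite -scaler_sumr IH.
set E := 'X^(_ - h %/ _).
(* The starts h - m and h + 1 differ by m + 1, which shifts both quotients by 1 and leaves the
   exponent unchanged. *)
have -> : alpha h *: ('X^((h - m + N) %/ m.+1 - (h - m) %/ m.+1) * dyck_poly alpha m (h - m))
    = 'X^((h.+1 + N) %/ m.+1 - h.+1 %/ m.+1) * (alpha h *: dyck_poly alpha m (h - m)).
  have [mh|/alpha0->] := leqP m h; last by rewrite !scale0r mulr0.
  have -> : (h.+1 + N = h - m + N + m.+1)%N by lia.
  have -> : (h.+1 = h - m + m.+1)%N by lia.
  by rewrite !(divnDr _ (dvdnn _)) subnDr scalerAr.
rewrite -mulrDr dyck_polyS // subrK mulrA; congr (_ * _); rewrite {}/E.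
have leh : (h.+1 %/ m.+1 <= (h.+1 + N) %/ m.+1)%N by apply: leq_div2r; lia.
rewrite addnS -addSn; have := divnS h (ltn0Sn m).
case: ifP => _ hE; last by rewrite mulr1 hE.
by rewrite -exprSr hE; congr ('X^_); lia.
Qed.

(** A fall in place of a rise costs m + 1 in height, which gives the height before step [i]. On
    illegal paths both sides vanish. *)
Lemma path_weightE (R : comNzRingType) (alpha : nat -> R) (m h : nat) (s : seq bool) :
  (forall j, (j < m)%N -> alpha j = 0) ->
  path_weight alpha m h s =
  \prod_(i < size s | ~~ nth true s i) alpha (h + i - m.+1 * count negb (take i s))%N.
Proof.
move=> alpha0; elim: s h => [|b s IH] h /=; first by rewrite big_ord0.
rewrite big_mkcond big_ord_recl /= muln0 subn0 addn0.
case: b => /=.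
  rewrite mul1r IH [LHS]big_mkcond; apply: eq_bigr => i _.
  by rewrite /bump /= add1n addnS.
have [mh|/alpha0->] := leqP m h; last by rewrite !mul0r.
rewrite IH [X in _ * X]big_mkcond; congr (_ * _); apply: eq_bigr => i _.
rewrite /bump /= add1n; case: ifP => // _; congr alpha.
by rewrite add0n mulnDr muln1; lia.
Qed.

Lemma count_take_sum (T : Type) (a : pred T) (x0 : T) (s : seq T) (i : nat) :
  count a (take i s) = (\sum_(j < size s | a (nth x0 s j)) (j < i))%N.
Proof.
elim: s i => [|x s IH] i /=; first by rewrite big_ord0.
rewrite big_mkcond big_ord_recl /=.
case: i => [|i] /=; first by rewrite if_same big1 // => j _; rewrite if_same.
rewrite IH [in LHS]big_mkcond /=; by case: (a x).
Qed.

Lemma rise_path_sum1 (V : nmodType) (N : nat) (Q : pred (seq bool)) (F : seq bool -> V) :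
  (forall s : N.-tuple bool, Q s = (count negb s == 0%N)) ->
  \sum_(s : N.-tuple bool | Q s) F s = F (nseq N true).
Proof.
move=> QE; rewrite (big_pred1 [tuple of nseq N true]) // => s; rewrite QE /=.
rewrite -val_eqE /= eqn0Ngt -has_count; move: (tval s) (size_tuple s) => t <-.
apply/idP/eqP => [/hasPn all_true|->]; last by rewrite has_nseq andbF.
by apply/all_pred1P/allP => b /all_true; rewrite /= negbK => ->.
Qed.

Lemma path_weight_rises (R : comNzRingType) (alpha : nat -> R) (m h N : nat) :
  path_weight alpha m h (nseq N true) = 1.
Proof. by elim: N h => //= N IH h. Qed.

Lemma end_height_rises (m h N : nat) : end_height m h (nseq N true) = (h + N)%N.
Proof. by elim: N h => /= [|N IH] h; rewrite ?addn0 // IH addnS. Qed.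

Lemma is_dyck_path_rises (m h N : nat) : is_dyck_path m h (nseq N true).
Proof. by elim: N h => /=. Qed.

(** * Recurrence coefficients as sums over paths of length m + 1 *)

Definition falls_at (N : nat) (A : {set 'I_N}) : N.-tuple bool :=
  [tuple j \notin A | j < N].

Definition fall_set (N : nat) (s : N.-tuple bool) : {set 'I_N} :=
  [set i | ~~ tnth s i].

Lemma nth_falls_at (N : nat) (A : {set 'I_N}) (i : 'I_N) :
  nth true (falls_at A) i = (i \notin A).
Proof. by rewrite -tnth_nth tnth_mktuple. Qed.

Lemma falls_atK (N : nat) : cancel (@falls_at N) (@fall_set N).
Proof. by move=> A; apply/setP => i; rewrite inE tnth_mktuple negbK. Qed.

Lemma fall_setK (N : nat) : cancel (@fall_set N) (@falls_at N).
Proof. by move=> s; apply: eq_from_tnth => i; rewrite tnth_mktuple inE negbK. Qed.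

Lemma count_take_falls_at (N i : nat) (A : {set 'I_N}) :
  count negb (take i (falls_at A)) = (\sum_(j in A) (j < i))%N.
Proof.
rewrite (count_take_sum _ true) size_tuple; apply: eq_bigl => j.
by rewrite nth_falls_at negbK.
Qed.

Lemma count_falls_at (N : nat) (A : {set 'I_N}) :
  count negb (falls_at A) = #|A|.
Proof.
rewrite -[falls_at A : seq bool](take_size) size_tuple count_take_falls_at -sum1_card.
by apply: eq_bigr => j _; rewrite ltn_ord.
Qed.

Lemma sorted_rev_enum_set (N : nat) (A : {set 'I_N}) :
  sorted (fun x y : 'I_N => (y < x)%N) (rev (enum A)).
Proof.
rewrite rev_sorted /enum_mem -enumT; apply: sorted_filter.
  by move=> y x z; exact: ltn_trans.
have := iota_ltn_sorted 0 N; rewrite -val_enum_ord sorted_map.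
exact: sub_sorted.
Qed.

Lemma rev_enum_decreasing (k N : nat) (l : {ffun 'I_k -> 'I_N}) :
  (forall i j : 'I_k, (i < j)%N -> (l j < l i)%N) ->
  rev (enum (l @: 'I_k)) = [seq l j | j <- enum 'I_k].
Proof.
move=> dec; apply: (irr_sorted_eq (leT := fun x y : 'I_N => (y < x)%N)).
- by move=> y x z /[swap]; exact: ltn_trans.
- by move=> x; rewrite ltnn.
- exact: sorted_rev_enum_set.
- have := iota_ltn_sorted 0 k; rewrite -val_enum_ord !sorted_map.
  by apply: sub_sorted => i j; exact: dec.
move=> x; rewrite mem_rev mem_enum; apply/imsetP/mapP => -[j _ ->]; exists j => //.
by rewrite mem_enum.
Qed.

Lemma sum_ltn_ord (k j : nat) : (j <= k)%N -> (\sum_(i < k) (j < i) = k - j.+1)%N.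
Proof.
elim: k => [|k IH]; first by rewrite big_ord0.
rewrite big_ord_recr /= leq_eqVlt => /predU1P[->|jk].
  by rewrite big1 => [|i _]; [lia | have := ltn_ord i; lia].
rewrite IH //; lia.
Qed.

(** The index l_j is the position of a fall, counted from the last. As k - j falls precede it, it
    starts at height (m+1)n + l_j - (m+1)(k-j), the index of [alpha] in [rec_coef] at [n - k]. *)
Lemma rec_coef_path_sum (R : comNzRingType) (alpha : nat -> R) (m n k : nat) :
  (forall j, (j < m)%N -> alpha j = 0) -> (k <= n)%N ->
  \sum_(s : m.+1.-tuple bool | count negb s == k.+1) path_weight alpha m (m.+1 * n) s
  = rec_coef alpha m k (n - k).
Proof.
move=> alpha0 kn.
pose dec (l : {ffun 'I_k.+1 -> 'I_m.+1}) :=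
  [forall i : 'I_k.+1, forall j : 'I_k.+1, (i < j)%N ==> (l j < l i)%N].
have decP (l : {ffun 'I_k.+1 -> 'I_m.+1}) :
    reflect (forall i j : 'I_k.+1, (i < j)%N -> (l j < l i)%N) (dec l).
  apply: (iffP forallP) => [h i j ij|h i]; first by have /forallP/(_ j)/implyP := h i; apply.
  by apply/forallP => j; apply/implyP; exact: h.
have dec_inj l : dec l -> injective l.
  move=> /decP ldec i j lij; apply: val_inj; case: (ltngtP i j) => // /ldec.
    by rewrite lij ltnn.
  by rewrite lij ltnn.
pose psi (s : m.+1.-tuple bool) : {ffun 'I_k.+1 -> 'I_m.+1} :=
  [ffun j : 'I_k.+1 => nth ord0 (rev (enum (fall_set s))) j].
have psi_dec (s : m.+1.-tuple bool) : count negb s = k.+1 ->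
    dec (psi s) /\ psi s @: 'I_k.+1 = fall_set s.
  rewrite -{1}(fall_setK s) count_falls_at => cs.
  have size_rev_enum : size (rev (enum (fall_set s))) = k.+1.
    by rewrite size_rev -cardE.
  split.
    apply/decP => i j ij; rewrite !ffunE.
    have := sorted_rev_enum_set (fall_set s).
    move/(sorted_ltn_nth (leT := fun x y : 'I_m.+1 => (y < x)%N)) => -> //.
    - by move=> y x z /[swap]; exact: ltn_trans.
    - by rewrite inE size_rev_enum.
    - by rewrite inE size_rev_enum.
  apply/setP => x; rewrite -[RHS]mem_enum -[RHS]mem_rev; apply/imsetP/(nthP ord0).
    by case=> j _ ->; exists j; rewrite ?size_rev_enum ?ffunE.
  by case=> j; rewrite size_rev_enum => jk <-; exists (Ordinal jk); rewrite ?inE ?ffunE.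
have psiK l : dec l -> psi (falls_at (l @: 'I_k.+1)) = l.
  move=> /decP ldec; apply/ffunP => j; rewrite ffunE falls_atK rev_enum_decreasing //.
  by rewrite (nth_map ord0) ?size_enum_ord // nth_ord_enum.
rewrite (reindex_onto (fun l : {ffun 'I_k.+1 -> 'I_m.+1} => falls_at (l @: 'I_k.+1)) psi);
  last by move=> s /eqP/psi_dec[_ ->]; rewrite fall_setK.
rewrite /rec_coef; apply: eq_big => [l|l ldec'].
  apply/andP/idP => [[/eqP/psi_dec[+ _] /eqP psil]|ldec]; first by rewrite psil.
  by rewrite psiK // count_falls_at card_imset ?card_ord ?eqxx //; exact: dec_inj.
have ldec : dec l.
  by case/andP: ldec' => /eqP/psi_dec[+ _] /eqP psil; rewrite psil.
rewrite path_weightE // size_tuple.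
under eq_bigl do rewrite nth_falls_at negbK.
rewrite big_imset /=; last by move=> i j _ _; exact: dec_inj.
rewrite (eq_bigl xpredT) => [|j]; last by rewrite inE.
apply: eq_bigr => j _; congr alpha.
rewrite count_take_falls_at big_imset /=; last by move=> i i' _ _; exact: dec_inj.
rewrite (eq_bigl xpredT) => [|i]; last by rewrite inE.
(* Since [l] decreases, the falls before position [l j] are the [l i] with [i > j]. *)
rewrite (eq_bigr (fun i : 'I_k.+1 => (j < i)%N : nat)); last first.
  move=> i _; congr nat_of_bool; move/decP: ldec => ldec.
  case: (ltngtP j i) => [/ldec ->//|/ldec|/val_inj->]; last by rewrite ltnn.
  by move=> h; apply/negbTE; rewrite -leqNgt ltnW.
rewrite sum_ltn_ord ?(ltnW (ltn_ord j)) // subSS.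
have := ltn_ord j; rewrite ltnS => jk.
have -> : (m.+1 * n = m.+1 * (n - k + j) + m.+1 * (k - j))%N by rewrite -mulnDr; congr muln; lia.
by rewrite addnAC addnK.
Qed.

Lemma dyck_poly0 (R : nzRingType) (alpha : nat -> R) (m : nat) :
  dyck_poly alpha m 0 = 1.
Proof. by []. Qed.

Lemma dyck_poly_recurrence (R : comNzRingType) (alpha : nat -> R) (m n : nat) :
  (forall j, (j < m)%N -> alpha j = 0) ->
  'X * dyck_poly alpha m (m.+1 * n) = dyck_poly alpha m (m.+1 * n.+1)
    + \sum_(k < (minn m n).+1)
        rec_coef alpha m k (n - k) *: dyck_poly alpha m (m.+1 * (n - k)).
Proof.
move=> alpha0; have := dyck_poly_path_sum (m.+1 * n) m.+1 alpha0.
rewrite (divnDr _ (dvdnn _)) divnn /= addKn => <-.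
(* The paths are sorted by their number of falls: none leads to (m+1)(n+1), and k + 1 falls lead to
   (m+1)(n-k). *)
rewrite (partition_big (fun s : m.+1.-tuple bool => inord (count negb s) : 'I_m.+2) xpredT) //=.
have cE (s : m.+1.-tuple bool) (k : 'I_m.+2) : (inord (count negb s) == k) = (count negb s == k).
  rewrite -val_eqE /= inordK // ltnS -[X in (_ <= X)%N](size_tuple s); exact: count_size.
under eq_bigr do under eq_bigl do rewrite cE.
rewrite big_ord_recl; congr (_ + _).
  rewrite (rise_path_sum1 (Q := fun s => count negb s == 0%N)
    (fun s => path_weight alpha m (m.+1 * n) s
       *: dyck_poly alpha m (end_height m (m.+1 * n) s))) //.
  by rewrite path_weight_rises scale1r end_height_rises mulnS addnC.
rewrite (big_ord_widen_cond m.+1 xpredT (fun k =>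
  rec_coef alpha m k (n - k) *: dyck_poly alpha m (m.+1 * (n - k)))); last by lia.
rewrite [RHS]big_mkcond /=; apply: eq_bigr => k _; rewrite /bump /= add1n.
have counts (s : m.+1.-tuple bool) : (count id s + count negb s = m.+1)%N.
  by rewrite count_id_negb size_tuple.
have -> : (k < (minn m n).+1)%N = (k <= n)%N by have := ltn_ord k; lia.
(* More than n + 1 falls would end below height 0, so such step lists have weight 0. *)
case: leqP => kn; last first.
  rewrite big1 // => s /eqP cs; rewrite (path_weight0 alpha0) ?scale0r //.
  apply/negP => /dyck_path_end; rewrite cs; have := counts s; rewrite cs => ? ?.
  have : (m.+1 * n.+1 <= m.+1 * k)%N by rewrite leq_mul2l kn orbT.
  by rewrite !mulSn mulnS; lia.
rewrite -rec_coef_path_sum // scaler_suml; apply: eq_bigr => s /eqP cs.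
case valid : (is_dyck_path m (m.+1 * n) s); last first.
  by rewrite path_weight0 ?valid // !scale0r.
congr (_ *: dyck_poly alpha m _).
have := dyck_path_end valid; rewrite cs; have := counts s; rewrite cs => ?.
have -> : (m.+1 * n = m.+1 * (n - k) + m.+1 * k)%N by rewrite -mulnDr subnK.
by rewrite [(m.+1 * k)%N]mulSn [(m * k.+1)%N]mulnS; lia.
Qed.

(** * Moments and orthogonality *)

Lemma stieltjes_rogers_gt (R : comNzRingType) (alpha : nat -> R) (m n k : nat) :
  (n < k)%N -> stieltjes_rogers alpha m n k = 0.
Proof.
move=> nk; rewrite /stieltjes_rogers /dyck_sum big1 // => s /andP[/dyck_path_end + /eqP eh].
rewrite eh add0n => endE; have := count_size id s; rewrite -endE size_tuple.
by move/(leq_trans (leq_addr _ _)); rewrite leq_pmul2l // leqNgt nk.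
Qed.

(** Only rises reach the maximal height. With the preceding lemma, the matrix of the
    Stieltjes-Rogers polynomials is unitriangular. *)
Lemma stieltjes_rogers_diag (R : comNzRingType) (alpha : nat -> R) (m n : nat) :
  stieltjes_rogers alpha m n n = 1.
Proof.
rewrite /stieltjes_rogers /dyck_sum.
rewrite (rise_path_sum1 (Q := fun s => is_dyck_path m 0 s && (end_height m 0 s == m.+1 * n)%N)
  (path_weight alpha m 0)); first exact: path_weight_rises.
move=> s; have := count_id_negb s; rewrite size_tuple => cs.
apply/andP/eqP => [[/dyck_path_end + /eqP eh]|c0]; first by rewrite eh; lia.
suff -> : (s : seq bool) = nseq (m.+1 * n) true.
  by rewrite is_dyck_path_rises end_height_rises.
rewrite -{2}(size_tuple s); apply/all_pred1P; rewrite all_count.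
have -> : count (pred1 true) s = count id s by apply: eq_count => -[].
by rewrite size_tuple; apply/eqP; lia.
Qed.

Lemma polyXn_stieltjes_rogers (R : comNzRingType) (alpha : nat -> R) (m n : nat) :
  (forall j, (j < m)%N -> alpha j = 0) ->
  'X^n = \sum_(i < n.+1) stieltjes_rogers alpha m n i *: dyck_poly alpha m (m.+1 * i).
Proof.
move=> alpha0; have := dyck_poly_path_sum 0 (m.+1 * n) alpha0.
rewrite add0n div0n subn0 mulKn // dyck_poly0 mulr1 => <-.
rewrite (bigID (fun s : (m.+1 * n).-tuple bool => is_dyck_path m 0 s)) /=.
rewrite [X in _ + X]big1 ?addr0; last by move=> s /(path_weight0 alpha0)->; rewrite scale0r.
(* The length is a multiple of m + 1, hence so is the end height. *)
have endE (s : (m.+1 * n).-tuple bool) : is_dyck_path m 0 s ->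
    (end_height m 0 s = m.+1 * (n - count negb s))%N /\ (count negb s <= n)%N.
  move=> /dyck_path_end; have := count_id_negb s; rewrite size_tuple => ? ?.
  have cn : (count negb s <= n)%N.
    by rewrite -(leq_pmul2l (ltn0Sn m)) [(m.+1 * count negb s)%N]mulSn; lia.
  by split=> //; rewrite mulnBr [(m.+1 * count negb s)%N]mulSn; lia.
rewrite (partition_big (fun s : (m.+1 * n).-tuple bool =>
  inord (n - count negb s) : 'I_n.+1) xpredT) //=.
apply: eq_bigr => i _; rewrite /stieltjes_rogers /dyck_sum scaler_suml.
apply: eq_big => [s|s /andP[/endE[-> cn] /eqP <-]]; last by rewrite inordK // ltnS leq_subr.
case valid : (is_dyck_path m 0 s) => //=; have [-> cn] := endE s valid.
by rewrite -val_eqE /= inordK ?ltnS ?leq_subr // eqn_pmul2l.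
Qed.

(** Applying [v] to the expansion of 'X^n gives a unitriangular system, solved by strong induction:
    among the lower terms only the one of index [j] survives. *)
Lemma dyck_poly_dual (R : comNzRingType) (alpha : nat -> R) (m j n : nat)
    (v : {scalar {poly R}}) :
  (forall j, (j < m)%N -> alpha j = 0) ->
  (forall n, v 'X^n = stieltjes_rogers alpha m n j) ->
  v (dyck_poly alpha m (m.+1 * n)) = (n == j)%:R.
Proof.
move=> alpha0 vX; elim/ltn_ind: n => n IH.
have := vX n; rewrite (polyXn_stieltjes_rogers n alpha0) linear_sum big_ord_recr /=.
rewrite stieltjes_rogers_diag scale1r addrC => /eqP; rewrite eq_sym -subr_eq => /eqP <-.
rewrite (eq_bigr (fun i : 'I_n => if val i == j then stieltjes_rogers alpha m n j else 0)).
  rewrite -big_mkcond /=; case: (ltngtP n j) => nj.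
  - rewrite big1 => [|i /eqP ij]; last by have := ltn_ord i; lia.
    by rewrite stieltjes_rogers_gt // subr0.
  - by rewrite (big_pred1 (Ordinal nj)) // subrr.
  - rewrite big1 => [|i /eqP ij]; last by have := ltn_ord i; lia.
    by rewrite -nj stieltjes_rogers_diag subr0.
by move=> i _; rewrite linearZ /= IH //; case: eqP => [->|_]; rewrite ?mulr1 ?mulr0.
Qed.

(** Multiplication by 'X lowers the index by at most [m], so after [k] of them all indices still
    exceed [j]. *)
Lemma dyck_poly_orthogonal (R : comNzRingType) (alpha : nat -> R) (m j k n : nat)
    (v : {scalar {poly R}}) :
  (forall j, (j < m)%N -> alpha j = 0) ->
  (forall n, v 'X^n = stieltjes_rogers alpha m n j) ->
  (m * k + j < n)%N -> v ('X^k * dyck_poly alpha m (m.+1 * n)) = 0.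
Proof.
move=> alpha0 vX; elim: k n => [|k IH] n.
  by rewrite muln0 add0n mul1r (dyck_poly_dual _ alpha0 vX) => jn; rewrite gtn_eqF.
move=> kn; rewrite exprSr -mulrA dyck_poly_recurrence // mulrDr linearD /= IH ?add0r; last by lia.
rewrite mulr_sumr linear_sum big1 // => i _.
by rewrite -scalerAr linearZ /= IH ?mulr0 //; have := ltn_ord i; lia.
Qed.

(** * Uniqueness of the orthogonal sequence, and positivity of the coefficients *)

Lemma monic_basis_expansion (R : nzRingType) (P : nat -> {poly R}) (n : nat)
    (p : {poly R}) :
  (forall n, P n \is monic) -> (forall n, size (P n) = n.+1) ->
  (size p <= n)%N -> exists c : nat -> R, p = \sum_(i < n) c i *: P i.
Proof.
move=> mon sz; elim: n p => [|n IH] p.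
  by rewrite leqn0 size_poly_eq0 => /eqP ->; exists (fun=> 0); rewrite big_ord0.
move=> pn; have [] := IH (p - p`_n *: P n).
  apply/leq_sizeP => i; rewrite leq_eqVlt => /predU1P[<-|ni].
    have := mon n; rewrite monicE lead_coefE sz /= => /eqP Pn.
    by rewrite coefB coefZ Pn mulr1 subrr.
  rewrite coefB coefZ (nth_default _ (leq_trans pn ni)).
  by rewrite (nth_default _ (_ : size (P n) <= i)%N) ?sz // mulr0 subr0.
move=> c pE; exists (fun i => if i == n then p`_n else c i).
rewrite big_ord_recr /= eqxx -[LHS](subrK (p`_n *: P n)) pE; congr (_ + _).
by apply: eq_bigr => i _; rewrite ltn_eqF.
Qed.

(** For i = dq + j, the functional u_j(X^q .) kills every P_i' with i' > i but not P_i. The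
    coefficients of [p] thus solve a triangular system and vanish in increasing order. *)
Lemma d_orthogonal_eq0 (R : idomainType) (d n : nat) (u : 'I_d -> {scalar {poly R}})
    (P : nat -> {poly R}) (p : {poly R}) :
  (0 < d)%N -> d_orthogonal (fun k => u k : {poly R} -> R) P -> (size p <= n)%N ->
  (forall (j : 'I_d) (k : nat), (d * k + j < n)%N -> u j ('X^k * p) = 0) -> p = 0.
Proof.
move=> d0 [mon sz orth] pn up; have [c pE] := monic_basis_expansion mon sz pn.
suff c0 i : (i < n)%N -> c i = 0.
  by rewrite pE big1 // => i _; rewrite c0 ?scale0r.
elim/ltn_ind: i => i IH ltin; pose j := Ordinal (ltn_pmod i d0).
have iE : i = (d * (i %/ d) + j)%N by rewrite mulnC -divn_eq.
have := up j (i %/ d)%N; rewrite -iE => /(_ ltin).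
rewrite pE mulr_sumr linear_sum (bigD1 (Ordinal ltin)) //= big1 => [|i' ne].
  rewrite addr0 -scalerAr linearZ /= => /eqP; rewrite mulf_eq0 => /orP[/eqP//|/eqP].
  by have [/(_ iE)] := orth j (i %/ d)%N i.
rewrite -scalerAr linearZ /=; case: (ltngtP i' i) => [lt|gt|eq].
- by rewrite IH ?mul0r.
- have [_ ->] := orth j (i %/ d)%N i'; first by rewrite mulr0.
  by rewrite -iE addn1.
- by case/eqP: ne; apply: val_inj.
Qed.

Lemma rec_coef_gt0 (R : numDomainType) (alpha : nat -> R) (m k n : nat) :
  (forall j, (j < m)%N -> alpha j = 0) -> (forall j, (m <= j)%N -> 0 < alpha j) ->
  (k <= m)%N -> 0 < rec_coef alpha m k n.
Proof.
move=> alpha0 alpha_gt0 km.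
have alpha_ge0 j : 0 <= alpha j by have [/alpha_gt0/ltW//|/alpha0->] := leqP m j.
(* For l_j = m - j every index is (m+1)n + mj + m, at least [m], so this term is positive; the
   others are nonnegative. *)
pose l : {ffun 'I_k.+1 -> 'I_m.+1} := [ffun j : 'I_k.+1 => inord (m - j)].
have lE j : l j = (m - j)%N :> nat by rewrite ffunE inordK // ltnS leq_subr.
rewrite /rec_coef (bigD1 l) /=; last first.
  apply/forallP => i; apply/forallP => j; apply/implyP => ij; rewrite !lE.
  by have := ltn_ord j; lia.
rewrite ltr_pwDl //; last by apply: sumr_ge0 => i _; apply: prodr_ge0.
apply: prodr_gt0 => j _; apply: alpha_gt0; rewrite lE.
case: (val j) => [|i]; first by rewrite subn0 leq_addl.
by rewrite addnS mulnS; lia.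
Qed.

(** * Zeros and recurrence of the orthogonal polynomials *)

Unset Implicit Arguments.
Local Open Scope classical_set_scope.
Local Open Scope ring_scope.

Theorem theorem4p8 (R : realType) (m : nat) (hm : (0 < m)%N)
    (alpha : nat -> R)
    (alpha0 : forall j, (j < m)%N -> alpha j = 0)
    (alpha_gt0 : forall k, 0 < alpha (k + m)%N)
    (u : 'I_m -> {scalar {poly R}})
    (mu : 'I_m -> {measure set (measurableTypeR R) -> \bar R})
    (P : nat -> {poly R})
    (u_moments : forall (k : 'I_m) (n : nat),
       u k 'X^n = stieltjes_rogers alpha m n k)
    (mu_support : forall k : 'I_m, mu k [set x : R | x < 0] = 0%E)
    (mu_moments : forall (k : 'I_m) (n : nat),
       (\int[mu k]_(x in setT) (x ^+ n)%:E)%E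
         = (mod_stieltjes_rogers alpha m k n)%:E)
    (P_orth_u : d_orthogonal (fun k => u k : {poly R} -> R) P)
    (P_orth_mu : d_orthogonal (fun k => integral_functional (mu k)) P) :
  [/\ forall n, zeros_simple_real_positive (P n),
      forall n, zeros_interlace (P n) (P n.+1),
      P 0%N = 1 /\
      (forall n, P n.+1 =
         'X * P n - \sum_(k < (minn m n).+1)
                      rec_coef alpha m k (n - k) *: P (n - k)%N)
    & forall n k : nat, (k <= m)%N -> 0 < rec_coef alpha m k n].
Proof.
have alpha_gt0' j : (m <= j)%N -> 0 < alpha j by move=> /subnK <-.
have PE n : P n = dyck_poly alpha m (m.+1 * n).
  have [monP sizeP orthP] := P_orth_u.
  have [monA sizeA] := dyck_poly_monic_size (m.+1 * n) alpha0.
  rewrite mulKn // in sizeA.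
  (* Both polynomials are monic of degree [n] and satisfy the same vanishing relations, so their
     difference has smaller degree and is 0. *)
  apply/eqP; rewrite -subr_eq0; apply/eqP; apply: (d_orthogonal_eq0 (n := n) hm P_orth_u).
    apply/leq_sizeP => i; rewrite leq_eqVlt coefB => /predU1P[<-|ni].
      have := monP n; have := monA; rewrite !monicE !lead_coefE sizeP sizeA /=.
      by move=> /eqP -> /eqP ->; rewrite subrr.
    by rewrite !nth_default ?subrr ?sizeP ?sizeA.
  move=> j k kj; rewrite mulrBr linearB /=.
  have [_ ->] := orthP j k n; last by rewrite addn1.
  by rewrite (dyck_poly_orthogonal alpha0 (u_moments j) kj) subr0.
have interlaced n : interlaces (P n) (P n.+1).
  (* The indices differ by m + 1, the extreme case of the window. *)
  rewrite !PE; apply: dyck_poly_interlaces => //.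
  by rewrite mulnS addnC leqnn andbT -addn1 leq_add2l.
split.
- move=> n; have [d [_ [s [_ [Pn _ _ _ _]]]]] := interlaced n.
  exact: positive_zeros_simple_real Pn.
- by move=> n; apply: interlaces_zeros.
- split=> [|n]; first by rewrite PE muln0 dyck_poly0.
  rewrite PE [X in 'X * X]PE dyck_poly_recurrence // -addrA.
  under [X in _ = _ + (_ - X)]eq_bigr do rewrite PE.
  by rewrite subrr addr0.
- by move=> n k; apply: rec_coef_gt0.
Qed.
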